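(* Let $V_0$ be a real reflexive Banach space, $A:V_0\times V_0\to\mathbb R$ a symmetric bilinear form, $L:V_0\to\mathbb R$ a linear functional, and $J_\theta:V_0\to\mathbb R$ a Gâteaux differentiable functional whose differential $J'_\theta({\bf u},{\bf v})$ is linear in ${\bf v}$ (possibly nonlinear in ${\bf u}$). Suppose there are constants $M,B,T,D>0$ such that for all ${\bf u},{\bf v},{\bf w}\in V_0$ $$|A({\bf u},{\bf v})|\le M\|{\bf u}\|_{V_0}\|{\bf v}\|_{V_0},\quad A({\bf u},{\bf u})\ge B\|{\bf u}\|_{V_0}^2,\quad |L({\bf v})|\le T\|{\bf v}\|_{V_0},$$ $$J'_\theta({\bf u}+{\bf v},{\bf v})-J'_\theta({\bf u},{\bf v})\ge0,\qquad |J'_\theta({\bf u}+{\bf w},{\bf v})-J'_\theta({\bf u},{\bf v})|\le D\|{\bf v}\|_{V_0}\|{\bf w}\|_{V_0},$$ and for every ${\bf u}\in V_0$ there is $\tilde R>0$ with $|J'_\theta({\bf u},{\bf v})|\le\tilde R\|{\bf v}\|_{V_0}$ for all ${\bf v}\in V_0$. Let $G^k:V_0\times V_0\to\mathbb R$, $k=0,1,\dots$, be symmetric bilinear forms for which there are constants $\tilde M,\tilde B>0$ (independent of $k$) with $$|G^k({\bf u},{\bf v})|\le\tilde M\|{\bf u}\|_{V_0}\|{\bf v}\|_{V_0},\qquad G^k({\bf u},{\bf u})\ge\tilde B\|{\bf u}\|_{V_0}^2\qquad\forall k\in\{0,1,\dots\},\ \forall\,{\bf u},{\bf v}\in V_0,$$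 and there is $k_0\in\{0,1,\dots\}$ such that $$G^k({\bf u},{\bf u})\ge G^{k+1}({\bf u},{\bf u})\qquad\forall k\ge k_0,\ \forall\,{\bf u}\in V_0 .$$ Let $\gamma\in(0;\gamma_2)$, $\gamma_2=2B\tilde B/(M+D)^2$. Let $\bar{\bf u}\in V_0$ be the exact solution of $A(\bar{\bf u},{\bf v})+J'_\theta(\bar{\bf u},{\bf v})-L({\bf v})=0$ for all ${\bf v}\in V_0$. Then, for any ${\bf u}^0\in V_0$, the sequence $\{{\bf u}^k\}\subset V_0$ obtained by the nonstationary iterative method $$G^k({\bf u}^{k+1},{\bf v})=G^k({\bf u}^k,{\bf v})-\gamma\big[A({\bf u}^k,{\bf v})+J'_\theta({\bf u}^k,{\bf v})-L({\bf v})\big]\quad\forall\,{\bf v}\in V_0,\ k=0,1,\dots$$ converges strongly in $V_0$ to $\bar{\bf u}$, i.e. $\|{\bf u}^k-\bar{\bf u}\|_{V_0}\to0$ as $k\to\infty$.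
   Context: Under the stated hypotheses on $A$, $L$, $J_\theta$, the variational equation $A({\bf u},{\bf v})+J'_\theta({\bf u},{\bf v})-L({\bf v})=0$ for all ${\bf v}\in V_0$ (the Euler equation for minimizing $\frac12A({\bf u},{\bf u})-L({\bf u})+J_\theta({\bf u})$ over $V_0$) has a unique solution in $V_0$, called the exact solution. The forms $G^k$ are also assumed to satisfy: for every $Y\in V_0^*$ there is a unique ${\bf w}\in V_0$ with $G^k({\bf w},{\bf v})=Y({\bf v})$ for all ${\bf v}\in V_0$. *)

(* Defs.v *)
From HB Require Import structures.
From mathcomp Require Export all_boot all_order all_algebra.
From mathcomp Require Export all_classical all_reals all_analysis.
Export Order.TTheory GRing.Theory Num.Theory.
Export numFieldNormedType.Exports.

Set Implicit Arguments.
Unset Strict Implicit.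
Unset Printing Implicit Defensive.

Local Open Scope classical_set_scope.
Local Open Scope ring_scope.

(* [R^o] is [R] seen as a normed module over itself. *)
Definition topological_dual (R : realType) (V : normedModType R)
    : set (V -> R^o) :=
  [set f | linear f /\ continuous f].

Definition dual_norm (R : realType) (V : normedModType R) (f : V -> R^o) : R :=
  sup [set `|f x| | x in [set x : V | `|x| <= 1]].

(* The canonical map of [V] into its bidual is onto. An element of the bidual
   is represented by a function on all of [V -> R^o], of which only the
   restriction to the linear subspace [topological_dual V] is constrained. *)
Definition reflexive_space (R : realType) (V : normedModType R) : Prop :=
  forall Phi : (V -> R^o) -> R,
    (forall (a : R) (f g : V -> R^o),
        topological_dual f -> topological_dual g ->
        Phi (a *: f + g) = a * Phi f + Phi g) ->
    (exists C : R, forall f : V -> R^o,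
        topological_dual f -> `|Phi f| <= C * dual_norm f) ->
    exists x : V, forall f : V -> R^o, topological_dual f -> Phi f = f x.

(* Main.v *)
Require Import Defs.
From mathcomp Require Import lra.

(** The error [e_k = u_k - ubar] is controlled through its energy
    [G^k(e_k, e_k)].  Subtracting the equation satisfied by [ubar] gives
    [G^k(e_{k+1} - e_k, v) = - gamma * F_k(v)], where the residual
    [F_k(v) = A(e_k, v) + J'(u_k, v) - J'(ubar, v)] satisfies
    [|F_k(v)| <= (M + D) |e_k| |v|] (boundedness of [A], Lipschitz continuity
    of [J']) and [F_k(e_k) >= B |e_k|^2] (coercivity of [A], monotonicity of
    [J']).  Expanding [G^k(e_{k+1}, e_{k+1})] around [e_k], the linear term
    gains at least [2 gamma B |e_k|^2], while the quadratic term costs at most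
    [(gamma (M + D))^2 / Bt * |e_k|^2]; see [coercive_step_energy].  The bound
    on [gamma] says exactly that the gain wins, so the [G^k]-energy drops by
    [c |e_k|^2] with a constant [c > 0] that does not depend on [k].

    Replacing [G^k] by [G^{k+1}] does not increase the energy for [k >= k0],
    hence from [k0] on the numbers [G^k(e_k, e_k)] form a nonincreasing sequence
    bounded below by 0.  Such a sequence converges, its decrements tend to 0,
    and [c |e_k|^2] is dominated by these decrements
    ([cvg0_of_energy_decrease]). *)

Set Implicit Arguments.
Unset Strict Implicit.
Unset Printing Implicit Defensive.

Local Open Scope classical_set_scope.
Local Open Scope ring_scope.

Lemma cvg0_of_energy_decrease (R : realType) (E y : R ^nat) (c : R) (k0 : nat) :
  0 < c -> (forall k, 0 <= E k) -> (forall k, 0 <= y k) ->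
  (forall k, (k0 <= k)%N -> E k.+1 + c * y k <= E k) ->
  y @ \oo --> 0.
Proof.
move=> c0 E0 y0 dec.
pose x n := E (n + k0)%N.
have xdec n : x n.+1 + c * y (n + k0)%N <= x n.
  by rewrite /x addSn; apply: dec; rewrite leq_addl.
have xcvg : cvgn x.
  apply: nonincreasing_is_cvgn.
    apply/nonincreasing_seqP => n; apply: le_trans (xdec n).
    by rewrite lerDl mulr_ge0 // ltW.
  by exists 0 => _ [n _ <-]; exact: E0.
have decrement0 : (fun n => c^-1 * (x n - x n.+1)) @ \oo --> 0.
  rewrite -(mulr0 c^-1) -(subrr (limn x)); apply: cvgMr.
  by apply: cvgB => //; rewrite cvg_shiftS.
rewrite -(cvg_shiftn k0).
apply: (squeeze_cvgr _ (cvg_cst 0) decrement0).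
apply: nearW => n; rewrite y0 /= mulrC ler_pdivlMr // mulrC.
by rewrite lerBrDl.
Qed.

(** One step of a preconditioned iteration: [d] is the correction computed from
    a residual functional [F] at the error [e]. *)
Lemma coercive_step_energy (R : realType) (V : normedModType R)
    (G : {bilinear V -> V -> R^o}) (F : V -> R) (B Bt K gamma : R) (e d : V) :
  (forall u v, G u v = G v u) ->
  0 < Bt -> (forall v, Bt * `|v| ^+ 2 <= G v v) ->
  0 < gamma -> (forall v, G d v = - (gamma * F v)) ->
  B * `|e| ^+ 2 <= F e -> (forall v, `|F v| <= K * `|e| * `|v|) ->
  G (e + d) (e + d) + (2 * gamma * B - (gamma * K) ^+ 2 / Bt) * `|e| ^+ 2
    <= G e e.
Proof.
move=> symG Bt0 coerG g0 GdE coerF boundF.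
have expand : G (e + d) (e + d) = G e e - 2 * (gamma * F e) + G d d.
  rewrite linearDl /= !linearDr /= (symG e d) GdE; lra.
have Gdd_ub : G d d <= gamma * K * `|e| * `|d|.
  rewrite GdE -mulrN -!mulrA ler_wpM2l ?(ltW g0) // mulrA.
  by apply: le_trans (boundF d); rewrite -normrN ler_norm.
(* Young's inequality [2 a t <= a^2 + t^2] with [t = Bt |d|] lets coercivity
   absorb [|d|] without dividing by it. *)
have Gdd : G d d <= (gamma * K) ^+ 2 / Bt * `|e| ^+ 2.
  rewrite mulrAC ler_pdivlMr // -exprMn.
  have := coerG d; have := sqr_ge0 (gamma * K * `|e| - Bt * `|d|).
  move: (G d d) (`|d|) Gdd_ub => g t.
  move: (gamma * K * `|e|) => a.
  nra.
have gain : gamma * (B * `|e| ^+ 2) <= gamma * F e by rewrite ler_wpM2l ?(ltW g0).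
rewrite expand mulrBl; lra.
Qed.

Theorem theorem5 (R : realType) (V0 : completeNormedModType R)
  (reflV0 : reflexive_space V0)
  (A : {bilinear V0 -> V0 -> R^o}) (L : {linear V0 -> R^o}) (J : V0 -> R^o)
  (symA : forall u v : V0, A u v = A v u)
  (gateauxJ : forall u v : V0, derivable J u v)
  (linJ' : forall u : V0, linear (fun v : V0 => 'D_v J u))
  (M B T D : R) (M0 : 0 < M) (B0 : 0 < B) (T0 : 0 < T) (D0 : 0 < D)
  (boundA : forall u v : V0, `|A u v| <= M * `|u| * `|v|)
  (coerA : forall u : V0, A u u >= B * `|u| ^+ 2)
  (boundL : forall v : V0, `|L v| <= T * `|v|)
  (monoJ' : forall u v : V0, 'D_v J (u + v) - 'D_v J u >= 0)
  (lipJ' : forall u v w : V0,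
      `|'D_v J (u + w) - 'D_v J u| <= D * `|v| * `|w|)
  (boundJ' : forall u : V0, exists2 Rt : R, 0 < Rt &
      forall v : V0, `|'D_v J u| <= Rt * `|v|)
  (G : nat -> {bilinear V0 -> V0 -> R^o})
  (symG : forall (k : nat) (u v : V0), G k u v = G k v u)
  (Mt Bt : R) (Mt0 : 0 < Mt) (Bt0 : 0 < Bt)
  (boundG : forall (k : nat) (u v : V0), `|G k u v| <= Mt * `|u| * `|v|)
  (coerG : forall (k : nat) (u : V0), G k u u >= Bt * `|u| ^+ 2)
  (solvG : forall (k : nat) (Y : V0 -> R^o), topological_dual Y ->
      exists! w : V0, forall v : V0, G k w v = Y v)
  (decrG : exists k0 : nat, forall k : nat, (k0 <= k)%N ->
      forall u : V0, G k u u >= G k.+1 u u)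
  (gamma : R) (gamma0 : 0 < gamma) (gamma2 : gamma < 2 * B * Bt / (M + D) ^+ 2)
  (ubar : V0)
  (exact_ubar : forall v : V0, A ubar v + 'D_v J ubar - L v = 0)
  (u0 : V0) (u : nat -> V0) (u_init : u 0%N = u0)
  (u_step : forall (k : nat) (v : V0),
      G k (u k.+1) v = G k (u k) v - gamma * (A (u k) v + 'D_v J (u k) - L v)) :
  (fun k : nat => `|u k - ubar|) @ \oo --> (0 : R).
Proof.
have [k0 decr] := decrG.
set c : R := 2 * gamma * B - (gamma * (M + D)) ^+ 2 / Bt.
have c0 : 0 < c.
  have MD0 : 0 < (M + D) ^+ 2 by rewrite exprn_gt0 ?addr_gt0.
  move: gamma2; rewrite ltr_pdivlMr // => small.
  rewrite /c subr_gt0 ltr_pdivrMr // exprMn; nra.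
have boundF k v : `|A (u k - ubar) v + ('D_v J (u k) - 'D_v J ubar)|
    <= (M + D) * `|u k - ubar| * `|v|.
  apply: le_trans (ler_normD _ _) _.
  have := lipJ' ubar v (u k - ubar); rewrite (addrC ubar) subrK.
  have := boundA (u k - ubar) v; lra.
have coerF k : B * `|u k - ubar| ^+ 2
    <= A (u k - ubar) (u k - ubar)
       + ('D_(u k - ubar) J (u k) - 'D_(u k - ubar) J ubar).
  have := monoJ' ubar (u k - ubar); rewrite (addrC ubar) subrK.
  have := coerA (u k - ubar); lra.
have correction k v : G k (u k.+1 - u k) v
    = - (gamma * (A (u k - ubar) v + ('D_v J (u k) - 'D_v J ubar))).
  rewrite !linearBl /= u_step.
  have -> : L v = A ubar v + 'D_v J ubar.
    by apply/eqP; rewrite eq_sym -subr_eq0 exact_ubar.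
  lra.
have energy k : G k (u k.+1 - ubar) (u k.+1 - ubar) + c * `|u k - ubar| ^+ 2
    <= G k (u k - ubar) (u k - ubar).
  have -> : u k.+1 - ubar = (u k - ubar) + (u k.+1 - u k).
    by rewrite [RHS]addrC addrA subrK.
  exact: coercive_step_energy (symG k) Bt0 (coerG k) gamma0 (correction k)
    (coerF k) (boundF k).
have sqr_cvg0 : (fun k => `|u k - ubar| ^+ 2) @ \oo --> (0 : R).
  apply: (@cvg0_of_energy_decrease _
    (fun k => G k (u k - ubar) (u k - ubar)) _ c k0) => //.
  - by move=> k; apply: le_trans (coerG k _); rewrite mulr_ge0 ?sqr_ge0 ?ltW.
  - by move=> k lek; apply: le_trans (energy k); rewrite lerD2r; exact: decr.
have -> : (fun k => `|u k - ubar|)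
    = (fun k => Num.sqrt (`|u k - ubar| ^+ 2)).
  by apply/funext => k; rewrite sqrtr_sqr normr_id.
rewrite -(sqrtr0 R).
exact: continuous_cvg (@sqrt_continuous R 0) sqr_cvg0.
Qed.
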